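(* Let $m<n$ be positive integers, $\bm{A}\in\mathbb{R}^{m\times n}$, $\bm{x}\in\mathbb{R}^n$, $\eta_1\ge 0$, and let $\bm{b}=\bm{A}\bm{x}+\bm{z}$ with $\bm{z}\in\mathbb{R}^m$, $\|\bm{z}\|_1\le\eta_1$. Let $s\in\{1,\dots,n\}$, $0<\alpha\le 1$, and let $k>0$ be a real number such that $ks$ is a positive integer and $a(s,ks;\alpha):=\frac{\sqrt{ks}-\alpha}{\sqrt{s}+\alpha}>1$. Let $\hat{\bm{x}}^{\ell_1}$ be a minimizer of $$\min_{\bm{u}\in\mathbb{R}^n}\ \|\bm{u}\|_1-\alpha\|\bm{u}\|_2\quad\text{subject to}\quad\|\bm{b}-\bm{A}\bm{u}\|_1\le\eta_1.$$ If the $(\ell_2,\ell_1)$ restricted isometry constants of $\bm{A}$ satisfy $$\delta_{ks}^{ub}+a(s,ks;\alpha)\,\delta_{(k+1)s}^{lb}<a(s,ks;\alpha)-1,$$ then $$\|\hat{\bm{x}}^{\ell_1}-\bm{x}\|_2\le\frac{2(2\sqrt{k}+1)\sqrt{s}}{(2\sqrt{ks}-\alpha)\rho_{ks}}\,\eta_1+\frac{\sqrt{s}}{2\sqrt{ks}-\alpha}\left(\frac{(2\sqrt{k}+1)(1+\delta_{ks}^{ub})\sqrt{s}}{\rho_{ks}(\sqrt{ks}-\alpha)}+1\right)\frac{2\|\bm{x}_{-\max(s)}\|_1}{\sqrt{s}},$$ where $\rho_{ks}=1-\delta_{(k+1)s}^{lb}-\frac{1+\delta_{ks}^{ub}}{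a(s,ks;\alpha)}$.
   Context: A vector is $r$-sparse if it has at most $r$ nonzero coordinates. For a matrix $\bm{A}\in\mathbb{R}^{m\times n}$ and a positive integer $r$, the $(\ell_2,\ell_1)$ restricted isometry constants $\delta_r^{lb}$ and $\delta_r^{ub}$ of order $r$ are the smallest real numbers such that $$(1-\delta_r^{lb})\|\bm{u}\|_2\le\|\bm{A}\bm{u}\|_1\le(1+\delta_r^{ub})\|\bm{u}\|_2$$ for all $r$-sparse $\bm{u}\in\mathbb{R}^n$. For $\bm{x}\in\mathbb{R}^n$, $\bm{x}_{\max(s)}$ denotes $\bm{x}$ with all but its $s$ largest entries in absolute value set to zero (ties broken arbitrarily), and $\bm{x}_{-\max(s)}=\bm{x}-\bm{x}_{\max(s)}$. *)

(* Defs.v *)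
From mathcomp Require Import all_boot all_order all_algebra.
From mathcomp Require Import classical_sets reals.

Set Implicit Arguments.
Unset Strict Implicit.
Unset Printing Implicit Defensive.

Import Order.TTheory GRing.Theory Num.Theory.
Local Open Scope classical_set_scope.
Local Open Scope ring_scope.

(* The norm notation that MathComp-Analysis puts on matrices is the sup norm,
   hence these explicit l1 and l2 norms. *)
Definition l1norm (R : realType) (n : nat) (u : 'cV[R]_n) : R :=
  \sum_i `|u i 0|.

Definition l2norm (R : realType) (n : nat) (u : 'cV[R]_n) : R :=
  Num.sqrt (\sum_i u i 0 ^+ 2).

Definition sparse (R : realType) (n r : nat) (u : 'cV[R]_n) : bool :=
  (#|[pred i | (u i 0 != 0)%R]| <= r)%N.

Definition is_least (R : realType) (D : set R) (d : R) : Prop :=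
  D d /\ lbound D d.

Definition is_ric_lb (R : realType) (m n : nat) (A : 'M[R]_(m, n)) (r : nat)
    (d : R) : Prop :=
  is_least [set d' : R | forall u : 'cV[R]_n, sparse r u ->
    (1 - d') * l2norm u <= l1norm (A *m u)] d.

Definition is_ric_ub (R : realType) (m n : nat) (A : 'M[R]_(m, n)) (r : nat)
    (d : R) : Prop :=
  is_least [set d' : R | forall u : 'cV[R]_n, sparse r u ->
    l1norm (A *m u) <= (1 + d') * l2norm u] d.

(* Relational because of ties: y is x restricted to some set of s indices
   carrying s largest entries in absolute value. *)
Definition is_max_part (R : realType) (n s : nat) (x y : 'cV[R]_n) : Prop :=
  exists S : {set 'I_n},
    [/\ #|S| = s,
        forall i j, i \in S -> j \notin S -> `|x j 0| <= `|x i 0|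
      & y = \col_i (if i \in S then x i 0 else 0)].

Definition l1l2_objective (R : realType) (n : nat) (alpha : R)
    (u : 'cV[R]_n) : R :=
  l1norm u - alpha * l2norm u.

Definition l1l2_feasible (R : realType) (m n : nat) (A : 'M[R]_(m, n))
    (b : 'cV[R]_m) (eta : R) (u : 'cV[R]_n) : Prop :=
  l1norm (b - A *m u) <= eta.

Definition is_l1l2_minimizer (R : realType) (m n : nat) (A : 'M[R]_(m, n))
    (b : 'cV[R]_m) (eta alpha : R) (v : 'cV[R]_n) : Prop :=
  l1l2_feasible A b eta v /\
  forall u : 'cV[R]_n, l1l2_feasible A b eta u ->
    l1l2_objective alpha v <= l1l2_objective alpha u.

(* The second argument t stands for the product ks, a real number. *)
Definition a_const (R : realType) (s : nat) (t alpha : R) : R :=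
  (Num.sqrt t - alpha) / (Num.sqrt s%:R + alpha).

(* Main.v *)
Require Import Defs.
From mathcomp Require Import all_boot all_order all_algebra.
From mathcomp Require Import classical_sets reals.
From mathcomp Require Import fintype finset zify ring lra.

Set Implicit Arguments.
Unset Strict Implicit.
Unset Printing Implicit Defensive.

(** Put h = xhat - x, let S carry the s largest entries of x, let T carry the ks
    largest entries of h outside S (all of them if they are fewer), and let U be
    the set of remaining indices.  Write H = |h_(S u T)|_2, L = |h_(~S)|_1,
    sigma = |x_(~S)|_1, p = sqrt s and q = sqrt (ks).  Four facts are combined.

    - Cone condition ([cone_bound]).  Since x is feasible, xhat has the smaller
      objective, and the triangle inequality for the concave part
      - alpha |.|_2 of the objective costs only alpha |h|_2:
      L <= |h_S|_1 + 2 sigma + alpha |h|_2 <= p H + 2 sigma + alpha |h|_2.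
    - Block shifting ([block_shifting]).  Cut ~S into blocks of ks indices by
      decreasing absolute value; each entry of a block is at most the average
      of the previous block, so the l2 norms of the blocks after T sum to at
      most L / q.  Hence |A h_U|_1 <= (1 + delta_ub) L / q.
    - Tail bound ([l2norm_tail_le]).  Entries of h_U are at most |h_T|_1 / ks,
      so |h_U|_2^2 <= |h_T|_1 |h_U|_1 / ks, which is at most (L / (2 q))^2 by
      the inequality between arithmetic and geometric means.  This is where
      the factors 2 in the conclusion come from.
    - Tube condition.  Both x and xhat are feasible: |A h|_1 <= 2 eta1.

    Inserting |h|_2 <= H + |h_U|_2 in the cone condition and absorbing the
    resulting alpha L / q gives (q - alpha) L / q <= (p + alpha) H + 2 sigma.
    The lower isometry constant on S u T then yields
      (1 - delta_lb) H <= |A h|_1 + |A h_U|_1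
        <= 2 eta1 + (1 + delta_ub) (H / a + 2 sigma / (q - alpha)),
    that is, rho H <= 2 eta1 + 2 (1 + delta_ub) sigma / (q - alpha), with
    rho > 0 by the isometry assumption.  Finally
    2 q |h|_2 <= 2 q H + L turns, by the cone condition once more, into
    (2 q - alpha) |h|_2 <= (2 q + p) H + 2 sigma. *)

Import Order.TTheory GRing.Theory Num.Theory.
Local Open Scope ring_scope.

(** * The norms l1 and l2 *)

(** If either factor a, b on the right vanishes then so does every product;
    otherwise expand 0 <= \sum (b u - a v)^2 = 2 a b (a b - \sum u v). *)
Lemma cauchy_schwarz_sum (R : rcfType) (I : finType) (P : pred I) (u v : I -> R) :
  \sum_(i | P i) u i * v i <=
  Num.sqrt (\sum_(i | P i) u i ^+ 2) * Num.sqrt (\sum_(i | P i) v i ^+ 2).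
Proof.
have sq_ge0 w : 0 <= \sum_(i | P i) w i ^+ 2 :> R.
  by apply: sumr_ge0 => i _; exact: sqr_ge0.
set a := Num.sqrt (\sum_(i | P i) u i ^+ 2).
set b := Num.sqrt (\sum_(i | P i) v i ^+ 2).
have zero w : Num.sqrt (\sum_(i | P i) w i ^+ 2) = 0 ->
    forall i, P i -> w i = 0 :> R.
  move/eqP; rewrite sqrtr_eq0 => w_le0 i Pi.
  have /psumr_eq0P : \sum_(i | P i) w i ^+ 2 = 0.
    by apply/eqP; rewrite eq_le w_le0 sq_ge0.
  move=> /(_ (fun j _ => sqr_ge0 (w j)) i Pi) /eqP.
  by rewrite sqrf_eq0 => /eqP.
have [a0|a_neq0] := eqVneq a 0.
  by rewrite a0 mul0r big1 // => i Pi; rewrite (zero u a0 i Pi) mul0r.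
have [b0|b_neq0] := eqVneq b 0.
  by rewrite b0 mulr0 big1 // => i Pi; rewrite (zero v b0 i Pi) mulr0.
have ab_gt0 : 0 < a * b by rewrite mulr_gt0 // lt0r ?a_neq0 ?b_neq0 sqrtr_ge0.
have aE : \sum_(i | P i) u i ^+ 2 = a ^+ 2 by rewrite sqr_sqrtr.
have bE : \sum_(i | P i) v i ^+ 2 = b ^+ 2 by rewrite sqr_sqrtr.
have := sq_ge0 (fun i => b * u i - a * v i).
have -> : \sum_(i | P i) (b * u i - a * v i) ^+ 2 =
    2 * (a * b) * (a * b - \sum_(i | P i) u i * v i).
  transitivity (b ^+ 2 * (\sum_(i | P i) u i ^+ 2)
      + a ^+ 2 * (\sum_(i | P i) v i ^+ 2)
      - 2 * (a * b) * \sum_(i | P i) u i * v i); last by rewrite aE bE; ring.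
  rewrite !mulr_sumr -big_split -sumrB; apply: eq_bigr => i _ /=; ring.
by rewrite pmulr_rge0 ?subr_ge0 // mulr_gt0.
Qed.

Section Norms.
Variables (R : realType) (n : nat).
Implicit Types u v : 'cV[R]_n.

Lemma l1norm_ge0 u : 0 <= l1norm u.
Proof. by apply: sumr_ge0. Qed.

Lemma l1normD u v : l1norm (u + v) <= l1norm u + l1norm v.
Proof.
by rewrite /l1norm -big_split; apply: ler_sum => i _; rewrite mxE ler_normD.
Qed.

Lemma l1normN u : l1norm (- u) = l1norm u.
Proof. by apply: eq_bigr => i _; rewrite mxE normrN. Qed.

Lemma l2norm_ge0 u : 0 <= l2norm u.
Proof. exact: sqrtr_ge0. Qed.

Lemma sqr_l2norm u : l2norm u ^+ 2 = \sum_i u i 0 ^+ 2.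
Proof. by rewrite sqr_sqrtr // sumr_ge0 // => i _; exact: sqr_ge0. Qed.

Lemma l2normD u v : l2norm (u + v) <= l2norm u + l2norm v.
Proof.
rewrite -(@ler_pXn2r _ 2) ?nnegrE ?addr_ge0 ?l2norm_ge0 //.
rewrite sqrrD !sqr_l2norm.
have -> : \sum_i (u + v) i 0 ^+ 2 = \sum_i u i 0 ^+ 2
    + (\sum_i u i 0 * v i 0) *+ 2 + \sum_i v i 0 ^+ 2.
  by rewrite -sumrMnl -!big_split; apply: eq_bigr => i _; rewrite mxE sqrrD.
by rewrite lerD2r lerD2l ler_pMn2r // cauchy_schwarz_sum.
Qed.

End Norms.

(** * Selecting the largest entries *)

(** The set is built greedily, adding at each step a largest remaining entry. *)
Lemma top_subset (R : realDomainType) (I : finType) (g : I -> R)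
    (U : {set I}) (r : nat) :
  (r <= #|U|)%N ->
  exists T : {set I}, [/\ T \subset U, #|T| = r &
    forall i j, i \in T -> j \in U :\: T -> g j <= g i].
Proof.
elim: r => [_|r IHr lt_rU].
  by exists set0; split; rewrite ?sub0set ?cards0 // => i j; rewrite inE.
have [T [TU cT Tmax]] := IHr (ltnW lt_rU).
have /card_gt0P[i0 i0UT] : (0 < #|U :\: T|)%N.
  by rewrite cardsD (setIidPr TU) cT subn_gt0.
have [i iUT imax] := @arg_maxP _ _ _ i0 (mem (U :\: T)) g i0UT.
have /setDP[iU iT] := iUT.
exists (i |: T); split; first by rewrite subUset sub1set iU.
  by rewrite cardsU1 iT cT.
move=> i' j /setU1P[->|i'T]; rewrite !inE negb_or -andbA => /and3P[_ jT jU].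
  by apply: imax; apply/finset.setDP.
by apply: Tmax; rewrite ?inE ?jT.
Qed.

(** The selected indices are r in number unless they exhaust U, so an entry left
    out is at most the average of r entries, each at least as large.  In the
    exhausted case nothing is left out, so that a block with fewer than r
    elements needs no separate treatment later on. *)
Lemma dominating_subset (R : realDomainType) (I : finType) (g : I -> R)
    (U : {set I}) (r : nat) :
  exists T : {set I}, [/\ T \subset U, #|T| = minn r #|U| &
    forall j, j \in U :\: T -> r%:R * g j <= \sum_(i in T) g i].
Proof.
have [T [TU cT Tmax]] := top_subset g (geq_minr r #|U|).
exists T; split=> // j jUT.
have cTr : #|T| = r.
  move: cT; rewrite /minn; case: ltnP => // _ cTU.
  have eqTU : T = U by apply/eqP; rewrite eqEcard TU cTU leqnn.
  by move: jUT; rewrite eqTU setDv inE.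
rewrite mulrC mulr_natr -{1}cTr -sumr_const.
by apply: ler_sum => i iT; exact: Tmax.
Qed.

(** * Restriction of a vector to a set of indices *)

Definition restr (R : realType) n (U : {set 'I_n}) (h : 'cV[R]_n) : 'cV[R]_n :=
  \col_i (if i \in U then h i 0 else 0).

Section Restriction.
Variables (R : realType) (n : nat).
Implicit Types (u h x : 'cV[R]_n) (U S T : {set 'I_n}).

Lemma sum_restr (g : R -> R) U h : g 0 = 0 ->
  \sum_i g (restr U h i 0) = \sum_(i in U) g (h i 0).
Proof.
move=> g0; rewrite [RHS]big_mkcond; apply: eq_bigr => i _.
by rewrite mxE; case: ifP.
Qed.

Lemma l1norm_restr U h : l1norm (restr U h) = \sum_(i in U) `|h i 0|.
Proof. by rewrite -(sum_restr (g := Num.norm)) ?normr0. Qed.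

Lemma sqr_l2norm_restr U h : l2norm (restr U h) ^+ 2 = \sum_(i in U) h i 0 ^+ 2.
Proof. by rewrite sqr_l2norm (sum_restr (g := fun t => t ^+ 2)) ?expr0n. Qed.

Lemma restr_setID U T h : T \subset U ->
  restr U h = restr T h + restr (U :\: T) h.
Proof.
move=> /subsetP TU; apply/colP => i; rewrite !mxE inE.
by have [/TU->|_] := boolP (i \in T); rewrite ?addr0 ?add0r.
Qed.

Lemma restrC U h : restr U h + restr (~: U) h = h.
Proof.
by apply/colP => i; rewrite !mxE inE; case: (i \in U); rewrite ?addr0 ?add0r.
Qed.

Lemma l1normC U h : l1norm h = l1norm (restr U h) + l1norm (restr (~: U) h).
Proof.
rewrite !l1norm_restr /l1norm (bigID (mem U)) /=; congr (_ + _).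
by apply: eq_bigl => i; rewrite inE.
Qed.

Lemma sparse_restr U r h : (#|U| <= r)%N -> sparse r (restr U h).
Proof.
apply: leq_trans; apply: subset_leq_card; apply/subsetP => i.
by rewrite inE mxE; case: ifP; rewrite ?eqxx.
Qed.

Lemma l2norm_restr_mono S U h : S \subset U ->
  l2norm (restr S h) <= l2norm (restr U h).
Proof.
move=> SU; rewrite -(@ler_pXn2r _ 2) ?nnegrE ?l2norm_ge0 // !sqr_l2norm_restr.
rewrite [leRHS](big_setID S) /= (setIidPr SU) lerDl sumr_ge0 // => i _.
exact: sqr_ge0.
Qed.

Lemma l1norm_restr_le_l2 S h :
  l1norm (restr S h) <= Num.sqrt #|S|%:R * l2norm (restr S h).
Proof.
have sq1 : \sum_(i in S) 1 ^+ 2 = #|S|%:R :> R by rewrite expr1n sumr_const.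
have sqh : \sum_(i in S) `|h i 0| ^+ 2 = l2norm (restr S h) ^+ 2.
  rewrite sqr_l2norm_restr; apply: eq_bigr => i _.
  by rewrite real_normK ?num_real.
have := cauchy_schwarz_sum (mem S) (fun=> 1) (fun i => `|h i 0|).
rewrite sq1 sqh sqrtr_sqr ger0_norm ?l2norm_ge0 // l1norm_restr.
by under eq_bigr do rewrite mul1r.
Qed.

(** * Sorted blocks *)

(** W plays the role of the l1 norm of a preceding block of r larger entries.  Then
    r |h_U|_2^2 <= W |h_U|_1, and 4 W L <= (W + L)^2. *)
Lemma l2norm_tail_le U r h W :
  (forall j, j \in U -> r%:R * `|h j 0| <= W) -> 0 <= W ->
  2 * Num.sqrt r%:R * l2norm (restr U h) <= W + l1norm (restr U h).
Proof.
move=> hW W_ge0; set L := l1norm _.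
have L_ge0 : 0 <= L by exact: l1norm_ge0.
rewrite -(@ler_pXn2r _ 2) ?nnegrE ?addr_ge0 ?mulr_ge0 ?l2norm_ge0 ?sqrtr_ge0 //.
rewrite !exprMn sqr_sqrtr ?ler0n // sqr_l2norm_restr.
have : r%:R * (\sum_(i in U) h i 0 ^+ 2) <= W * L.
  rewrite /L l1norm_restr !mulr_sumr; apply: ler_sum => i iU.
  by rewrite -real_normK ?num_real // expr2 mulrA ler_wpM2r // hW.
have := sqr_ge0 (W - L); nra.
Qed.

(** The induction peels off a dominating block T of U: W bounds r times the
    entries of T, whence sqrt r |h_T|_2 <= W, and the l1 norm of h_T takes the
    place of W for U minus T.  The function f stands for |A _|_1, which is only
    controlled on sparse vectors, hence one block at a time. *)
Lemma block_shifting f C U r h W : (0 < r)%N -> 0 <= C ->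
  (forall u v, f (u + v) <= f u + f v) ->
  (forall u, sparse r u -> f u <= C * l2norm u) ->
  (forall j, j \in U -> r%:R * `|h j 0| <= W) -> 0 <= W ->
  Num.sqrt r%:R * f (restr U h) <= C * (W + l1norm (restr U h)).
Proof.
move=> r_gt0 C_ge0 fD f_sparse.
elim: {U}#|U| {-2}U (leqnn #|U|) W => [|N IHN] U cU W hW W_ge0.
  have U0 : U = set0 by apply/eqP; rewrite -cards_eq0 -leqn0.
  have l0 : l2norm (restr U h) = 0.
    by apply/eqP; rewrite -sqrf_eq0 sqr_l2norm_restr U0 big_set0.
  apply: (@le_trans _ _ 0).
    rewrite mulr_ge0_le0 ?sqrtr_ge0 // (le_trans (f_sparse _ _)) //.
      by apply: sparse_restr; rewrite U0 cards0.
    by rewrite l0 mulr0.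
  by rewrite mulr_ge0 ?addr_ge0 ?l1norm_ge0.
have [T [TU cT hT]] := dominating_subset (fun i => `|h i 0|) U r.
have cTr : (#|T| <= r)%N by rewrite cT geq_minl.
(* No factor is lost although T may have fewer than r elements: multiplied by
   r, the squared claim sums #|T| <= r terms, each at most W^2. *)
have headT : Num.sqrt r%:R * l2norm (restr T h) <= W.
  rewrite -(@ler_pXn2r _ 2) ?nnegrE ?mulr_ge0 ?l2norm_ge0 ?sqrtr_ge0 //.
  rewrite exprMn sqr_sqrtr ?ler0n // sqr_l2norm_restr.
  rewrite -(@ler_pM2l _ r%:R) ?ltr0n // mulrA -expr2 mulr_sumr.
  apply: (@le_trans _ _ (\sum_(i in T) W ^+ 2)).
    apply: ler_sum => i iT; rewrite -(real_normK (num_real (h i 0))) -exprMn.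
    by rewrite ler_pXn2r ?nnegrE ?mulr_ge0 // hW // (subsetP TU).
  by rewrite sumr_const -[W ^+ 2 *+ _]mulr_natl ler_wpM2r ?sqr_ge0 // ler_nat.
have cUT : (#|U :\: T| <= N)%N.
  by move: cU r_gt0; rewrite cardsD (setIidPr TU) cT; clear; move: #|U| => c; lia.
have := IHN _ cUT (l1norm (restr T h)) _ (l1norm_ge0 _).
rewrite {1}l1norm_restr => /(_ hT) tailT.
have L1 : l1norm (restr U h) = l1norm (restr T h) + l1norm (restr (U :\: T) h).
  by rewrite !l1norm_restr (big_setID T) /= (setIidPr TU).
rewrite L1 (restr_setID _ TU).
apply: (le_trans (ler_wpM2l (sqrtr_ge0 _) (fD _ _))).
rewrite mulrDr mulrDr; apply: lerD tailT.
apply: (le_trans (ler_wpM2l (sqrtr_ge0 _) (f_sparse _ (sparse_restr _ cTr)))).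
by rewrite mulrCA ler_wpM2l.
Qed.

(** * Estimates for the minimization problem *)

(** On S the l1 norm loses at most |(u - x)_S|_1 when passing from x to u; off S
    the triangle inequality charges x twice. *)
Lemma cone_bound (alpha : R) S x u : 0 <= alpha ->
  l1l2_objective alpha u <= l1l2_objective alpha x ->
  l1norm (restr (~: S) (u - x)) <= l1norm (restr S (u - x))
    + 2 * l1norm (restr (~: S) x) + alpha * l2norm (u - x).
Proof.
rewrite /l1l2_objective => alpha_ge0 obj.
have /(ler_wpM2l alpha_ge0) : l2norm u <= l2norm (u - x) + l2norm x.
  by rewrite -{1}(subrK x u) l2normD.
have onS : l1norm (restr S x) <= l1norm (restr S u) + l1norm (restr S (u - x)).
  rewrite !l1norm_restr -big_split; apply: ler_sum => i _ /=.
  by rewrite !mxE -{1}[x i 0](subKr (u i 0)) ler_normB.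
have offS : l1norm (restr (~: S) (u - x)) <=
    l1norm (restr (~: S) u) + l1norm (restr (~: S) x).
  rewrite !l1norm_restr -big_split; apply: ler_sum => i _ /=.
  by rewrite !mxE ler_normB.
by move: obj; rewrite (l1normC S u) (l1normC S x); lra.
Qed.

End Restriction.

(** Tested on a coordinate vector, whose l2 norm is 1. *)
Lemma ric_ub_geN1 (R : realType) m n (A : 'M[R]_(m, n)) r d :
  (0 < n)%N -> (0 < r)%N -> is_ric_ub A r d -> -1 <= d.
Proof.
case: n A => // n A _ r_gt0 [/(_ (restr [set ord0] (const_mx 1))) + _].
rewrite sparse_restr ?cards1 // => /(_ isT).
have -> : l2norm (restr [set (@ord0 n)] (const_mx 1 : 'cV[R]_n.+1)) = 1.
  apply/eqP; rewrite -(@eqrXn2 _ 2) ?l2norm_ge0 // sqr_l2norm_restr big_set1.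
  by rewrite mxE expr1n.
by rewrite mulr1 => /(le_trans (l1norm_ge0 _)); lra.
Qed.

Theorem theorem2 (R : realType) (m n : nat) (m_gt0 : (0 < m)%N)
    (lt_mn : (m < n)%N)
    (A : 'M[R]_(m, n)) (x : 'cV[R]_n) (eta1 : R) (eta1_ge0 : 0 <= eta1)
    (z b : 'cV[R]_m) (bE : b = A *m x + z) (z_le : l1norm z <= eta1)
    (s : nat) (s_gt0 : (0 < s)%N) (s_le_n : (s <= n)%N)
    (alpha : R) (alpha_gt0 : 0 < alpha) (alpha_le1 : alpha <= 1)
    (k : R) (k_gt0 : 0 < k)
    (ks : nat) (ks_gt0 : (0 < ks)%N) (ksE : k * s%:R = ks%:R)
    (a_gt1 : 1 < a_const s (k * s%:R) alpha)
    (xhat : 'cV[R]_n) (xhat_min : is_l1l2_minimizer A b eta1 alpha xhat)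
    (xmax : 'cV[R]_n) (xmaxP : is_max_part s x xmax)
    (delta_ub delta_lb : R)
    (delta_ubP : is_ric_ub A ks delta_ub)
    (delta_lbP : is_ric_lb A (ks + s) delta_lb)
    (ric_lt : delta_ub + a_const s (k * s%:R) alpha * delta_lb
              < a_const s (k * s%:R) alpha - 1) :
  let rho := 1 - delta_lb - (1 + delta_ub) / a_const s (k * s%:R) alpha in
  l2norm (xhat - x) <=
    2 * (2 * Num.sqrt k + 1) * Num.sqrt s%:R
      / ((2 * Num.sqrt (k * s%:R) - alpha) * rho) * eta1
    + Num.sqrt s%:R / (2 * Num.sqrt (k * s%:R) - alpha)
      * ((2 * Num.sqrt k + 1) * (1 + delta_ub) * Num.sqrt s%:R
           / (rho * (Num.sqrt (k * s%:R) - alpha)) + 1)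
      * (2 * l1norm (x - xmax) / Num.sqrt s%:R).
Proof.
rewrite ksE in a_gt1 ric_lt *; cbv zeta.
set a := a_const _ _ _ in a_gt1 ric_lt *; set rho := 1 - delta_lb - _.
set p := Num.sqrt s%:R; set q := Num.sqrt ks%:R.
have p_gt0 : 0 < p by rewrite sqrtr_gt0 ltr0n.
have q_gt0 : 0 < q by rewrite sqrtr_gt0 ltr0n.
have aE : a * (p + alpha) = q - alpha by rewrite mulfVK // gt_eqF // addr_gt0.
have q_alpha : 0 < q - alpha.
  by rewrite -aE mulr_gt0 ?addr_gt0 // (lt_trans ltr01).
have a_gt0 : 0 < a by exact: lt_trans a_gt1.
have sqrtkE : Num.sqrt k * p = q by rewrite -sqrtrM ?ltW // ksE.
set C := 1 + delta_ub.
have C_ge0 : 0 <= C.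
  by rewrite -lerBlDl sub0r (ric_ub_geN1 _ ks_gt0 delta_ubP) ?(leq_trans _ lt_mn).
have aC : a * (C / a) = C by rewrite mulrCA divff ?mulr1 // gt_eqF.
have rho_gt0 : 0 < rho.
  by rewrite -(pmulr_rgt0 _ a_gt0) /rho -/C !mulrBr aC /C; lra.
have [S [cS _ xmaxE]] := xmaxP.
have xE : x - xmax = restr (~: S) x.
  by rewrite xmaxE -{1}(restrC S x) [restr S x + _]addrC addrK.
set sigma := l1norm (x - xmax).
have [xhat_feas xhat_obj] := xhat_min.
have x_feas : l1l2_feasible A b eta1 x.
  by rewrite /l1l2_feasible bE addrC addKr.
set h := xhat - x.
have := cone_bound S (ltW alpha_gt0) (xhat_obj x x_feas).
rewrite -/h -xE -/sigma => cone.
have Ah : l1norm (A *m h) <= 2 * eta1.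
  have -> : A *m h = z - (b - A *m xhat).
    by rewrite bE mulmxBr; apply/colP => i; rewrite !mxE; ring.
  apply: (le_trans (l1normD _ _)); rewrite l1normN.
  by move: xhat_feas z_le; rewrite /l1l2_feasible; lra.
have [T [TU cT hT]] := dominating_subset (fun i => `|h i 0|) (~: S) ks.
set U := ~: S :\: T.
have UE : U = ~: (S :|: T) by rewrite /U setCU setDE.
set H := l2norm (restr (S :|: T) h).
have hE : h = restr (S :|: T) h + restr U h by rewrite UE restrC.
have LE : l1norm (restr (~: S) h) = l1norm (restr T h) + l1norm (restr U h).
  by rewrite !l1norm_restr (big_setID T) /= (setIidPr TU).
set L := l1norm (restr (~: S) h).
rewrite -l1norm_restr in hT.
have [delta_ub_bound _] := delta_ubP.
have [delta_lb_bound _] := delta_lbP.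
have tail2 : 2 * q * l2norm (restr U h) <= L.
  by rewrite /L LE; apply: l2norm_tail_le; last exact: l1norm_ge0.
have tailA : q * l1norm (A *m restr U h) <= C * L.
  rewrite /L LE; apply: (block_shifting (f := fun u => l1norm (A *m u))) => //.
    by move=> u v; rewrite mulmxDr l1normD.
  exact: l1norm_ge0.
have headA : (1 - delta_lb) * H <= l1norm (A *m restr (S :|: T) h).
  apply: delta_lb_bound; apply: sparse_restr.
  rewrite (leq_trans (leq_card_setU _ _).1) // cS addnC leq_add2r.
  by rewrite cT geq_minl.
have splitA : l1norm (A *m restr (S :|: T) h) <=
    l1norm (A *m h) + l1norm (A *m restr U h).
  have -> : A *m restr (S :|: T) h = A *m h - A *m restr U h.
    by rewrite {2}hE mulmxDr addrK.
  by rewrite -[X in _ <= _ + X]l1normN l1normD.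
have hsplit : l2norm h <= H + l2norm (restr U h) by rewrite {1}hE l2normD.
have headS : l1norm (restr S h) <= p * H.
  apply: (le_trans (l1norm_restr_le_l2 _ _)); rewrite cS ler_wpM2l ?sqrtr_ge0 //.
  by apply: l2norm_restr_mono; exact: subsetUl.
set t := l2norm (restr U h) in tail2 hsplit.
set AU := l1norm (A *m restr U h) in tailA splitA.
have t_ge0 : 0 <= t by exact: l2norm_ge0.
rewrite -/L in cone.
(* The term alpha |h|_2 of the cone condition is absorbed on the left, using
   q t <= L. *)
have coneL : (q - alpha) * L <= q * ((p + alpha) * H + 2 * sigma).
  have ah := ler_wpM2l (ltW alpha_gt0) hsplit.
  have qt_ge0 : 0 <= q * t by exact: mulr_ge0 (ltW q_gt0) t_ge0.
  have qt_le : q * t <= L by move: tail2; rewrite -mulrA; lra.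
  have aqt := ler_wpM2l (ltW alpha_gt0) qt_le.
  have qL : q * L <= q * (p * H + 2 * sigma + alpha * (H + t)).
    by rewrite ler_wpM2l ?(ltW q_gt0) //; lra.
  lra.
have AU_le : (q - alpha) * AU <= C * ((p + alpha) * H + 2 * sigma).
  rewrite -(ler_pM2l q_gt0) mulrCA.
  apply: (le_trans (ler_wpM2l (ltW q_alpha) tailA)).
  by rewrite mulrCA [leRHS]mulrCA ler_wpM2l.
have CaE : C * (p + alpha) = C / a * (q - alpha).
  by rewrite -aE mulrA divfK // gt_eqF.
have H_le : H <= (2 * eta1 + 2 * C * sigma / (q - alpha)) / rho.
  rewrite ler_pdivlMr // -(ler_pM2l q_alpha) [leRHS]mulrDr.
  rewrite [X in _ <= _ + X]mulrC divfK ?gt_eqF // /rho -/C.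
  have := ler_wpM2l (ltW q_alpha) (le_trans headA splitA).
  have := ler_wpM2l (ltW q_alpha) Ah.
  have CE : C * ((p + alpha) * H + 2 * sigma)
      = C / a * (q - alpha) * H + 2 * C * sigma by rewrite -CaE; ring.
  move: AU_le; rewrite CE; lra.
(* Here the sharper 2 q t <= L is needed. *)
have h_le : (2 * q - alpha) * l2norm h <= (2 * q + p) * H + 2 * sigma.
  have := ler_wpM2l (ltW q_gt0) hsplit; lra.
have q2_alpha : 0 < 2 * q - alpha by lra.
rewrite [leRHS](_ : _ = ((2 * q + p)
    * ((2 * eta1 + 2 * C * sigma / (q - alpha)) / rho) + 2 * sigma)
    / (2 * q - alpha)).
  rewrite ler_pdivlMr // mulrC; apply: (le_trans h_le).
  by rewrite lerD2r ler_wpM2l // addr_ge0 ?mulr_ge0 // ltW.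
rewrite -sqrtkE; field.
by rewrite sqrtkE !gt_eqF.
Qed.
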